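(* Let $n\ge 5$ be odd, $\alpha_4,\dots,\alpha_n,\theta\in\mathbb{C}$, and let $L=F_1(\alpha_4,\alpha_5,\dots,\alpha_n,\theta)$. Then $L$ is non-strongly nilpotent if and only if the parameters satisfy at least one of the following: i) $\alpha_4\ne0$ and $\alpha_k=(-1)^kC^{2}_{k-3}\,\alpha_4^{k-3}$ for all $5\le k\le n-2$; ii) there is an integer $s$ with $3\le s\le\frac{n-3}{2}$ such that $\alpha_{(2s-3)t+3}=(-1)^{t+1}C^{2s-2}_{t}\,\alpha_{2s}^{t}$ for all $1\le t\le\lfloor\frac{n-5}{2s-3}\rfloor$, and $\alpha_j=0$ for every $4\le j\le n-2$ that is not of the form $j=(2s-3)t+3$ with $t$ a positive integer; iii) $\alpha_{2i}=0$ for all $2\le i\le\frac{n-1}{2}$; iv) there is an integer $s$ with $2\le s\le\frac{n-3}{2}$ such that $\alpha_{(2s-2)t+3}=(-1)^{t+1}C^{2s-1}_{t}\,\alpha_{2s+1}^{t}$ for all $1\le t\le\lfloor\frac{n-5}{2s-2}\rfloor$, and $\alpha_j=0$ for every $4\le j\le n-2$ that is not of the form $j=(2s-2)t+3$ with $t$ a positive integer. (The parameters not constrained in the respective case are arbitrary.) Here $C^{p}_{m}=\frac{1}{(p-1)m+1}\binom{pm}{m}$ is the $p$-th Catalan number.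
   Context: A (right) Leibniz algebra is a vector space $L$ with a bilinear bracket satisfying $[[x,y],z]=[[x,z],y]+[x,[y,z]]$ for all $x,y,z\in L$. A pre-derivation of $L$ is a linear map $P:L\to L$ with $P([[x,y],z])=[[P(x),y],z]+[[x,P(y)],z]+[[x,y],P(z)]$ for all $x,y,z\in L$. A Leibniz algebra is strongly nilpotent if every pre-derivation of it is a nilpotent linear map; otherwise it is non-strongly nilpotent. For $\alpha_4,\dots,\alpha_n,\theta\in\mathbb{C}$, $F_1(\alpha_4,\dots,\alpha_n,\theta)$ is the $n$-dimensional complex (filiform) Leibniz algebra with basis $e_1,\dots,e_n$ and products $[e_1,e_1]=e_3$; $[e_i,e_1]=e_{i+1}$ for $2\le i\le n-1$; $[e_1,e_2]=\sum_{t=4}^{n-1}\alpha_te_t+\theta e_n$; $[e_j,e_2]=\sum_{t=j+2}^{n}\alpha_{t-j+2}e_t$ for $2\le j\le n-2$; all omitted products of basis elements are zero. *)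

(* Defs.v *)
From HB Require Import structures.
From mathcomp Require Import all_boot all_order all_algebra.
From mathcomp Require Import reals complex.
From mathcomp Require Import zify.
Set Implicit Arguments.
Unset Strict Implicit.
Unset Printing Implicit Defensive.
Import GRing.Theory.
Local Open Scope ring_scope.

(* Right Leibniz algebras over a field K. *)
Record leibniz_algebra (K : fieldType) := LeibnizAlgebra {
  leib_sort :> lmodType K;
  bracket : {bilinear leib_sort -> leib_sort -> leib_sort};
  leibniz_id : forall x y z : leib_sort,
    bracket (bracket x y) z = bracket (bracket x z) y + bracket x (bracket y z)
}.

Arguments bracket {K l}.

Definition prederivation (K : fieldType) (L : leibniz_algebra K)
    (P : {linear L -> L}) : Prop :=
  forall x y z : L,
    P (bracket (bracket x y) z) =
      bracket (bracket (P x) y) z + bracket (bracket x (P y)) z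
      + bracket (bracket x y) (P z).

Definition nilpotent_map (K : fieldType) (V : lmodType K)
    (f : {linear V -> V}) : Prop :=
  exists k : nat, forall v : V, iter k f v = 0.

Definition strongly_nilpotent (K : fieldType) (L : leibniz_algebra K) : Prop :=
  forall P : {linear L -> L}, prederivation P -> nilpotent_map P.

(* The basis vector e_i of K^n, numbered from 1; it is 0 unless 1 <= i <= n. *)
Definition F1_basis (K : fieldType) (n i : nat) : 'rV[K]_n :=
  \row_(j < n) (j.+1 == i)%N%:R.

(* [e_i, e_j], indices from 1; alpha is only used at 4, ..., n. *)
Definition F1_mul (K : fieldType) (n : nat) (alpha : nat -> K) (theta : K)
    (i j : nat) : 'rV[K]_n :=
  let e := F1_basis K n in
  if ((i == 1) && (j == 1))%N then e 3%N
  else if ((2 <= i <= n - 1) && (j == 1))%N then e i.+1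
  else if ((i == 1) && (j == 2))%N then
    \sum_(4 <= t < n) alpha t *: e t + theta *: e n
  else if ((2 <= i <= n - 2) && (j == 2))%N then
    \sum_(i + 2 <= t < n.+1) alpha (t - i + 2)%N *: e t
  else 0.

Definition F1_bracket (K : fieldType) (n : nat) (alpha : nat -> K) (theta : K)
    (x y : 'rV[K]_n) : 'rV[K]_n :=
  \sum_(i < n) \sum_(j < n)
    (x 0 i * y 0 j) *: F1_mul n alpha theta i.+1 j.+1.

Lemma F1_bracket_bilinear (K : fieldType) (n : nat) (alpha : nat -> K)
    (theta : K) :
  bilinear_for *:%R *:%R (@F1_bracket K n alpha theta).
Proof.
split=> [y a x x' | x a y y']; rewrite /F1_bracket /= scaler_sumr -big_split /=;
  apply: eq_bigr => i _; rewrite scaler_sumr -big_split /=;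
  apply: eq_bigr => j _; rewrite !mxE scalerA -scalerDl; congr (_ *: _).
- by rewrite mulrDl mulrA.
- by rewrite mulrDr mulrCA.
Qed.

HB.instance Definition _ (K : fieldType) (n : nat) (alpha : nat -> K)
    (theta : K) :=
  bilinear_isBilinear.Build K 'rV[K]_n 'rV[K]_n 'rV[K]_n *:%R *:%R
    (@F1_bracket K n alpha theta) (F1_bracket_bilinear n alpha theta).

Section F1Leibniz.
Variables (K : fieldType) (n : nat) (alpha : nat -> K) (theta : K).
Hypothesis n_gt4 : (4 < n)%N.

Local Notation e := (F1_basis K n).
Local Notation mul := (F1_mul n alpha theta).

Let rmul (j : nat) (x : 'rV[K]_n) : 'rV[K]_n :=
  \sum_(i < n) x 0 i *: mul i.+1 j.

Let rmul_lin j : linear (rmul j).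
Proof.
move=> a x y; rewrite /rmul scaler_sumr -big_split /=; apply: eq_bigr => i _.
by rewrite !mxE scalerA scalerDl.
Qed.

HB.instance Definition _ j :=
  GRing.isLinear.Build K 'rV[K]_n 'rV[K]_n *:%R (rmul j) (rmul_lin j).

Let e_out k : (n < k)%N -> e k = 0.
Proof.
move=> lt_nk; apply/rowP=> j; rewrite !mxE; case: eqP => // Ek.
by move: (ltn_ord j); rewrite Ek leqNgt lt_nk.
Qed.

Let rmul_e j k : (0 < k <= n)%N -> rmul j (e k) = mul k j.
Proof.
case: k => // k /= lt_kn; rewrite /rmul (bigD1 (Ordinal lt_kn)) //= big1.
  by rewrite mxE eqxx scale1r addr0.
by move=> i ne_ik; rewrite mxE eqSS (negPf ne_ik : (_ == k) = _) scale0r.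
Qed.

Let mul_gt2 i j : (2 < j)%N -> mul i j = 0.
Proof. by case: j => [|[|[|j]]] //= _; rewrite /F1_mul /= !andbF. Qed.

Let mul1 i : (1 < i)%N -> mul i 1%N = e i.+1.
Proof.
move=> i_gt1; rewrite /F1_mul i_gt1 /= !andbT !andbF.
have -> : (i == 1)%N = false by case: i i_gt1 => [|[]].
case: leqP => // le_ni; rewrite e_out // ltnS.
by move: le_ni; rewrite subn1; case: n n_gt4.
Qed.

Let mul2 i : (1 < i)%N ->
  mul i 2%N = \sum_(i + 2 <= t < n.+1) alpha (t - i + 2)%N *: e t.
Proof.
move=> i_gt1; rewrite /F1_mul i_gt1 /= !andbT !andbF.
have -> : (i == 1)%N = false by case: i i_gt1 => [|[]].
case: leqP => // le_ni; rewrite big_geq //.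
lia.
Qed.

Let rmul1_e k : (1 < k)%N -> rmul 1%N (e k) = e k.+1.
Proof.
move=> k_gt1; case: (leqP k n) => [le_kn | lt_nk].
  by rewrite rmul_e ?mul1 // le_kn (ltnW k_gt1).
by rewrite !e_out ?(ltnW lt_nk) ?linear0 // ltnW.
Qed.

Let rmul12 i : (0 < i <= n)%N -> rmul 1%N (mul i 2%N) = rmul 2%N (mul i 1%N).
Proof.
case/andP; rewrite leq_eqVlt => /predU1P[<- _ | i_gt1 le_in].
  rewrite [mul 1%N 2%N]/F1_mul [mul 1%N 1%N]/F1_mul /= rmul_e ?mul2;
    [|lia..].
  rewrite !linearD !linearZ /= rmul1_e ?(ltn_trans _ n_gt4) //.
  rewrite [e n.+1]e_out // scaler0 addr0 linear_sum /= [RHS]big_add1 /=.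
  apply: eq_big_nat => t /andP[le4t _].
  by rewrite linearZ /= rmul1_e; [congr (alpha _ *: _); lia | lia].
rewrite mul2 // mul1 // linear_sum /=.
case: (leqP i.+1 n) => [lt_in | lt_ni].
  rewrite rmul_e // mul2; last lia.
  rewrite addSn [RHS]big_add1 /=.
  have [le_i2n | lt_ni2] := leqP (i + 2) n; last by rewrite !big_geq // ltnW.
  rewrite big_nat_recr //= linearZ /= rmul1_e; last lia.
  rewrite [e n.+1]e_out // scaler0 addr0; apply: eq_big_nat => t /andP[le_it _].
  by rewrite linearZ /= rmul1_e ?subSS //; lia.
rewrite e_out // linear0 big_geq //; lia.
Qed.

Let rmulC x j k : rmul j (rmul k x) = rmul k (rmul j x).
Proof.
have rmul_out l y : (l == 0)%N || (2 < l)%N -> rmul l y = 0.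
  case/predU1P=> [-> | l_gt2]; rewrite /rmul big1 // => i _.
    by rewrite /F1_mul /= !andbF scaler0.
  by rewrite mul_gt2 ?scaler0.
wlog lt_jk: j k / (j < k)%N => [IH|].
  by case: (ltngtP j k) => [|/IH|->] //; apply: IH.
case: (boolP ((j == 0)%N || (2 < j)%N)) => [oj | ij].
  by rewrite !(rmul_out j) // linear0.
case: (boolP ((k == 0)%N || (2 < k)%N)) => [ok | ik].
  by rewrite !(rmul_out k) // linear0.
have [-> ->] : j = 1%N /\ k = 2%N.
  by move: ij ik lt_jk; case: j => [|[|[|j]]] //; case: k => [|[|[|k]]].
rewrite {2}/rmul {3}/rmul !linear_sum /=; apply: eq_bigr => i _.
by rewrite !linearZ /= rmul12 //= ltn_ord.
Qed.

Let bracketE x y :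
  F1_bracket alpha theta x y = \sum_(j < n) y 0 j *: rmul j.+1 x.
Proof.
rewrite /F1_bracket exchange_big /=; apply: eq_bigr => j _.
rewrite /rmul scaler_sumr; apply: eq_bigr => i _.
by rewrite scalerA mulrC.
Qed.

Let rmul_sum j (x y : 'rV[K]_n) : rmul j (\sum_(k < n) y 0 k *: rmul k.+1 x) =
  \sum_(k < n) y 0 k *: rmul j (rmul k.+1 x).
Proof. by rewrite linear_sum; apply: eq_bigr => k _; rewrite linearZ. Qed.

Let mul_low i j (k : 'I_n) : (k < 2)%N -> mul i j 0 k = 0.
Proof.
move=> k_lt2; have e_low t : (2 < t)%N -> e t 0 k = 0.
  by move=> t_gt2; rewrite mxE ltn_eqF // (leq_ltn_trans _ t_gt2).
rewrite /F1_mul; case: ifP => _; first exact: e_low.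
case: ifP => [/andP[/andP[i_gt1 _] _] | _]; first exact: e_low.
case: ifP => _.
  rewrite !mxE summxE big_seq big1 ?add0r => [|t].
    by have := e_low n (ltn_trans _ n_gt4); rewrite mxE => ->; rewrite ?mulr0.
  rewrite mem_index_iota => /andP[le4t _].
  by rewrite mxE e_low ?mulr0 // (leq_trans _ le4t).
case: ifP => [/andP[/andP[i_gt1 _] _] | _]; last by rewrite mxE.
rewrite summxE big_seq big1 // => t; rewrite mem_index_iota => /andP[le_it _].
by rewrite mxE e_low ?mulr0 // (leq_trans _ le_it) // addn2 !ltnS ltnW.
Qed.

Lemma F1_bracket_basis (i j : nat) : (0 < i <= n)%N -> (0 < j <= n)%N ->
  F1_bracket alpha theta (e i) (e j) = mul i j.
Proof.
case: j => // j le_in /= lt_jn; rewrite bracketE (bigD1 (Ordinal lt_jn)) //=.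
rewrite big1 ?addr0 ?mxE ?eqxx ?scale1r ?rmul_e // => k ne_kj.
by rewrite mxE eqSS (negPf ne_kj : (_ == j) = _) scale0r.
Qed.

Lemma F1_leibniz_id (x y z : 'rV[K]_n) :
  let br := F1_bracket alpha theta in
  br (br x y) z = br (br x z) y + br x (br y z).
Proof.
rewrite /=; set br := F1_bracket alpha theta.
have -> : br x (br y z) = 0.
  rewrite /br (bracketE x) big1 // => j _; case: (ltnP j 2) => [j_lt2 | j_ge2].
    rewrite /F1_bracket summxE big1 ?scale0r // => i _.
    by rewrite summxE big1 // => k _; rewrite mxE mul_low ?mulr0.
  by rewrite /rmul big1 ?scaler0 // => i _; rewrite mul_gt2 ?scaler0.
rewrite addr0 /br !bracketE.
under eq_bigr => j _ do rewrite rmul_sum scaler_sumr.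
rewrite exchange_big /=; apply: eq_bigr => k _.
rewrite rmul_sum scaler_sumr; apply: eq_bigr => j _.
by rewrite rmulC !scalerA mulrC.
Qed.

End F1Leibniz.

Definition F1 (K : fieldType) (n : nat) (n_gt4 : (4 < n)%N)
    (alpha : nat -> K) (theta : K) : leibniz_algebra K :=
  @LeibnizAlgebra K 'rV[K]_n (@F1_bracket K n alpha theta)
    (F1_leibniz_id alpha theta n_gt4).

(* The p-th Catalan number C^p_m, an integer, as an element of K (of
   characteristic 0, e.g. the complex numbers). *)
Definition catalan (K : fieldType) (p m : nat) : K :=
  'C(p * m, m)%:R / ((p - 1) * m + 1)%:R.
Arguments catalan {K} p m.

(* Main.v *)
(* Put d = e_1 - e_2 and identify e_k, for k >= 2, with X^(k-2) in
   K[X]/(X^(n-1)).  Up to a multiple of the top vector e_n, right multiplication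
   by e_1 is multiplication by X and kills d, and right multiplication by e_2 is
   multiplication by X phi, where phi = alpha_4 X + ... + alpha_n X^(n-3).  Hence
   [[x,y],z] is X^2 mu_y mu_z x with mu_y = y_1 + y_2 phi.

   Taking y = z = e_1 in the definition shows that a pre-derivation acts on
   polynomials as p |-> q p + h X p' + v (p - p(-X)) with h = a + (b - a) phi,
   where a is its eigenvalue on d and b = q(0); the last term appears because
   only X^2, not X, is a double multiplication.  Taking y = e_1, z = e_2 leaves
   three conditions on G = h (X phi' + phi) - b phi and on D = phi - phi(-X):
   G = 0 mod X^(n-4), G + v D = 0 mod X^(n-3) and X v D = 0 mod X^(n-3).
   If D = 0 mod X^(n-3), which is case iii, then a = b = 0, v = 1/2 is a
   solution.  Otherwise v can be chosen as soon as G = 0 mod X^(n-4), and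
   a = b = 0 forces nilpotency.  If phi starts in degree m, then G = 0 forces
   b = (m+1) a and determines phi mod X^(n-4) by its first coefficient c; the
   solution is 1 - B(-c X^m), with B = 1 + z B^(m+1) the generating series of
   the Catalan numbers.  That this solves G = 0 is the quadratic Rothe-Hagen
   convolution identity. *)
Require Import Defs.
From HB Require Import structures.
From mathcomp Require Import all_boot all_order all_algebra.
From mathcomp Require Import reals complex.
From mathcomp Require Import zify ring.
From Stdlib Require Import Classical.
Set Implicit Arguments.
Unset Strict Implicit.
Unset Printing Implicit Defensive.
Import GRing.Theory Num.Theory.
Local Open Scope ring_scope.

(** * The Rothe-Hagen identity *)

Section RotheHagen.
Variable K : numFieldType.
Implicit Types p m r s t : nat.

(* The coefficient of z^t in B^r, where B = 1 + z B^p; the recurrence raneyS is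
   B^(r+1) = B^r + z B^(r+p). *)
Definition raney p r t : K :=
  if t is t'.+1 then r%:R / t%:R * 'C(r + p * t - 1, t')%:R else 1.

Lemma raney0 p t : raney p 0 t = (t == 0%N)%:R.
Proof. by case: t => [|t] //=; rewrite mul0r mul0r. Qed.

Lemma raneyS p r t : (0 < p)%N ->
  raney p r.+1 t.+1 = raney p r t.+1 + raney p (r + p) t.
Proof.
move=> p_gt0.
have nz k : k.+1%:R != 0 :> K by rewrite pnatr_eq0.
(* This closed form also covers t = 0. With it the three terms of the recurrence only involve
   ['C(M, t)] and ['C(M.-1, t)], so that [field] can conclude. *)
have E : raney p (r + p) t =
    (r + p)%:R / (r + p * t.+1)%:R * 'C(r + p * t.+1, t)%:R.
  case: t => [|t] /=.
    by rewrite bin0 mulr1 muln1 divff // pnatr_eq0; lia.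
  have -> : (r + p + p * t.+1 - 1 = (r + p * t.+2).-1)%N by lia.
  have := mul_bin_diag (r + p * t.+2) t.
  move/(congr1 (fun x => x%:R : K)); rewrite !natrM => E.
  have nz2 : (r + p * t.+2)%:R != 0 :> K by rewrite pnatr_eq0; lia.
  have nz1 := nz t.
  rewrite -[RHS](mulKf nz1) [X in _^-1 * X]mulrCA -E.
  move: nz1 nz2; move: t.+1%:R (r + p * t.+2)%:R => x y nz1 nz2.
  by field; rewrite nz1 nz2.
rewrite E /=.
set M := (r + p * t.+1)%N.
have -> : (r.+1 + p * t.+1 - 1 = M)%N by rewrite /M; lia.
have M_gt0 : (0 < M)%N by rewrite /M; lia.
have nzM : M%:R != 0 :> K by rewrite pnatr_eq0; lia.
have le_tM : (t <= M)%N by rewrite /M; nia.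
have := mul_bin_down M t; rewrite subn1.
move/(congr1 (fun x => x%:R : K)); rewrite !natrM natrB // => E1.
have -> : 'C(M.-1, t)%:R = (M%:R - t%:R) / M%:R * 'C(M, t)%:R :> K.
  by apply: (mulfI nzM); rewrite E1; field.
have EM : M%:R = r%:R + p%:R * (t%:R + 1) :> K by rewrite /M natrD natrM -natr1.
have nz1 := nz t; rewrite EM in nzM *; rewrite -!natr1 natrD in nz1 *.
by field; rewrite nz1 nzM.
Qed.

(* After induction on t, the recurrence raneyS shows that the difference of the
   two sides does not depend on r, and it vanishes for r = 0. *)
Lemma raney_convolution p r s t : (0 < p)%N ->
  \sum_(i < t.+1) raney p r i * raney p s (t - i) = raney p (r + s) t.
Proof.
move=> p_gt0; elim: t r => [|t IHt] r.
  by rewrite big_ord1 mulr1.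
elim: r => [|r IHr].
  rewrite big_ord_recl raney0 mul1r big1 ?addr0 // => i _.
  by rewrite raney0 mul0r.
rewrite big_ord_recl mul1r in IHr; rewrite big_ord_recl mul1r.
under eq_bigr => i _ do rewrite lift0 raneyS // mulrDl subSS.
rewrite big_split IHt addrA addSn raneyS // -IHr.
by rewrite addnAC.
Qed.

End RotheHagen.

(** * Catalan coefficients *)

Section CatalanSeries.
Variable K : numFieldType.
Implicit Types (m k t T : nat) (c : K) (a : nat -> K).

Lemma catalan_raney m t : catalan m.+1 t = raney K m.+1 1 t.
Proof.
case: t => [|t]; first by rewrite /catalan !muln0 bin0 divr1.
rewrite /catalan /raney subn1 /= add1n subn1 /=.
have := mul_bin_left (m.+1 * t.+1) t.
have -> : (m.+1 * t.+1 - t = m * t.+1 + 1)%N by nia.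
move/(congr1 (fun x => x%:R : K)); rewrite !natrM => E.
have nz1 : t.+1%:R != 0 :> K by rewrite pnatr_eq0.
have nz2 : (m * t.+1 + 1)%:R != 0 :> K by rewrite pnatr_eq0; lia.
apply: (mulfI nz1); rewrite mulrA E mul1r mulrA divff // mul1r mulrAC.
by rewrite divff ?mul1r.
Qed.

(** The sum is the coefficient of z^t in B * B = B^2, which [raney] gives in closed form; the
    factors record its ratio to the coefficient in B. *)
Lemma catalan_convolution m t :
  (m * t + 2)%:R * (\sum_(i < t.+1) catalan m.+1 i * catalan m.+1 (t - i))
  = 2 * (m.+1 * t + 1)%:R * catalan m.+1 t :> K.
Proof.
under eq_bigr => i _ do rewrite !catalan_raney.
rewrite raney_convolution // catalan_raney.
case: t => [|t]; first by rewrite /raney !muln0 !mulr1.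
rewrite /raney !add1n !add2n !subn1 /=.
have := mul_bin_down (m.+1 * t.+1).+1 t; rewrite /=.
have -> : ((m.+1 * t.+1).+1 - t = m * t.+1 + 2)%N by nia.
move/(congr1 (fun x => x%:R : K)); rewrite !natrM => E.
have nz1 : t.+1%:R != 0 :> K by rewrite pnatr_eq0.
rewrite mulrCA -E addn1.
by move: nz1; move: t.+1%:R ((m.+1 * t.+1).+1)%:R => x y nz1; field.
Qed.

(* The coefficients of 1 - B(-c X^m), where B is the generating series of the
   (m+1)-st Catalan numbers. *)
Definition catalan_coef m c k : K :=
  if (m %| k)%N && (0 < k)%N then
    (-1) ^+ (k %/ m).+1 * catalan m.+1 (k %/ m) * c ^+ (k %/ m)
  else 0.

Lemma catalan_coef_mul m c t : (0 < m)%N -> (0 < t)%N ->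
  catalan_coef m c (m * t) = (-1) ^+ t.+1 * catalan m.+1 t * c ^+ t.
Proof.
by move=> m0 t0; rewrite /catalan_coef dvdn_mulr //= muln_gt0 m0 t0 mulKn.
Qed.

Lemma catalan_coef0 m c : catalan_coef m c 0 = 0.
Proof. by rewrite /catalan_coef andbF. Qed.

Lemma catalan_coef_first m c : (0 < m)%N -> catalan_coef m c m = c.
Proof.
move=> m0; rewrite -[X in catalan_coef m c X]muln1 catalan_coef_mul //.
rewrite /catalan muln1 bin1 subn1 muln1 addn1 /= divff ?pnatr_eq0 //.
by rewrite sqrrN !mulr1 expr1 expr1n mul1r.
Qed.

Lemma catalan_coef_ndvd m c k : ~~ (m %| k)%N -> catalan_coef m c k = 0.
Proof. by rewrite /catalan_coef => /negPf ->. Qed.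

Lemma catalan_coef_lt m c k : (k < m)%N -> catalan_coef m c k = 0.
Proof.
case: k => [|k] lt_km; first exact: catalan_coef0.
by rewrite catalan_coef_ndvd // gtnNdvd.
Qed.

Lemma sum_multiples m t (F : nat -> K) : (0 < m)%N ->
  (forall i, ~~ (m %| i)%N -> F i = 0) ->
  \sum_(i < (m * t).+1) F i = \sum_(j < t.+1) F (m * j)%N.
Proof.
move=> m0 F0; elim: t => [|t IHt]; first by rewrite muln0 !big_ord1 muln0.
rewrite [RHS]big_ord_recr /= -IHt mulnS addnC.
rewrite -!(big_mkord xpredT F) (big_cat_nat (n := (m * t).+1)) //=; last lia.
congr (_ + _); rewrite big_nat_recr /=; last lia.
rewrite big_nat_cond big1 ?add0r // => i /andP[/andP[lt1 lt2] _].
apply: F0; apply/negP => /dvdnP[q Eq].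
have : (t < q)%N by nia.
nia.
Qed.

(** Reversing the sum exchanges the weights i + 1 and k - i + 1, whose total is k + 2. *)
Lemma sum_weighted_convolution a k :
  2 * \sum_(i < k.+1) i.+1%:R * a i * a (k - i)%N
  = (k + 2)%:R * \sum_(i < k.+1) a i * a (k - i)%N.
Proof.
rewrite mulr_natl mulr2n {1}(reindex_inj rev_ord_inj) /= -big_split mulr_sumr.
apply: eq_bigr => i _ /=; have le_ik : (i <= k)%N by rewrite -ltnS.
rewrite !subSS subKn // -[_ * a i]mulrA [a (k - i)%N * a i]mulrC -mulrA -mulrDl.
by rewrite -natrD; congr (_%:R * _); lia.
Qed.

(** This is G = 0, coefficient by coefficient, for a = 1 and b = m + 1. Symmetrizing the weight
    turns it into the plain convolution of the Catalan numbers. *)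
Lemma catalan_coef_rec m c k : (0 < m)%N ->
  (k%:R - m%:R) * catalan_coef m c k
  + m%:R * (\sum_(i < k.+1) i.+1%:R * catalan_coef m c i
                             * catalan_coef m c (k - i)%N) = 0.
Proof.
move=> m0; set a := catalan_coef m c.
apply: (mulfI (_ : 2 != 0 :> K)); first by rewrite pnatr_eq0.
rewrite mulr0 mulrDr [2 * (m%:R * _)]mulrCA sum_weighted_convolution.
have [/dvdnP[t ->] | ndv] := boolP (m %| k)%N; last first.
  rewrite [a k]catalan_coef_ndvd // big1 ?mulr0 ?addr0 // => i _.
  have [dvi|ndi] := boolP (m %| i)%N; last by rewrite [a i]catalan_coef_ndvd ?mul0r.
  rewrite [a (k - i)%N]catalan_coef_ndvd ?mulr0 //; apply: contraNN ndv => dv.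
  by rewrite -(subnK (_ : i <= k)%N) ?dvdn_add // -ltnS.
rewrite [(t * m)%N]mulnC (@sum_multiples _ _ (fun i => a i * a (m * t - i)%N)) //; last first.
  by move=> i ndi; rewrite [a i]catalan_coef_ndvd ?mul0r.
case: t => [|t].
  by rewrite muln0 big_ord1 /= muln0 [a _]catalan_coef0 !mulr0 addr0.
set S := \sum_(j < _) _.
(* The coefficient of index 0 is 0 here but 1 for the Catalan numbers, so the two end terms of the
   full convolution have to be removed. *)
have ES : S = (-1) ^+ t.+1 * c ^+ t.+1 *
    (\sum_(i < t.+2) catalan m.+1 i * catalan m.+1 (t.+1 - i)
       - 2 * catalan m.+1 t.+1).
  rewrite /S big_ord_recl big_ord_recr /= subnn [a (m * 0)%N]/a muln0.
  rewrite /bump /= ?add1n ?subnn ?muln0 catalan_coef0 mul0r ?add0r [a 0%N]catalan_coef0 mulr0 addr0.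
  rewrite [in RHS]big_ord_recl [in RHS]big_ord_recr /= /bump /= subnn subn0.
  have -> : catalan m.+1 0 = 1 :> K by rewrite /catalan !muln0 bin0 divr1.
  set X := catalan _ t.+1; rewrite mul1r mulr1; set Y := (Y in X + (Y + X)).
  have -> : X + (Y + X) - 2 * X = Y by ring.
  rewrite /Y mulr_sumr; apply: eq_bigr => i _.
  have lt_it := ltn_ord i.
  rewrite /a -mulnBr !catalan_coef_mul // ?lift0 /bump /= ?add1n ?subSS; try lia.
  have -> : (-1) ^+ t.+1 * c ^+ t.+1 =
     (-1) ^+ i.+2 * c ^+ i.+1 * ((-1) ^+ (t - i).+1 * c ^+ (t - i)).
    rewrite mulrACA -!exprD -addSnnS -[in RHS]signr_odd -[in LHS]signr_odd.
    congr ((-1) ^+ _ * c ^+ _); last lia.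
    by rewrite (_ : (i.+3 + (t - i))%N = t.+3) /=; [rewrite negbK|lia].
  by ring.
rewrite ES [a _]catalan_coef_mul //.
have E2 := catalan_convolution m t.+1.
move: E2; set S2 := \sum_(i < _) _; set C := catalan _ _; move=> E2.
have -> : m%:R * ((m * t.+1 + 2)%:R *
   ((-1) ^+ t.+1 * c ^+ t.+1 * (S2 - 2 * C))) =
   m%:R * ((-1) ^+ t.+1 * c ^+ t.+1) *
   ((m * t.+1 + 2)%:R * S2 - (m * t.+1 + 2)%:R * 2 * C) :> K by ring.
rewrite E2 !exprS !natrD !natrM -[m.+1%:R]natr1 -![t.+1%:R]natr1.
by ring.
Qed.

(** Beyond m the factor k - m is invertible, and since [a 0 = 0] the end terms of the sum drop out:
    the recurrence computes [a k] from earlier values. *)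
Lemma catalan_coef_unique m c N a : (0 < m)%N ->
  (forall k, (k < m)%N -> a k = 0) -> a m = c ->
  (forall k, (k < N)%N -> (k%:R - m%:R) * a k
     + m%:R * (\sum_(i < k.+1) i.+1%:R * a i * a (k - i)%N) = 0) ->
  forall k, (k < N)%N -> a k = catalan_coef m c k.
Proof.
move=> m0 a_lt am a_rec; elim/ltn_ind => k IHk lt_kN.
case: (ltngtP k m) => [lt_km | lt_mk | ->]; last by rewrite catalan_coef_first.
  by rewrite a_lt // catalan_coef_lt.
have nz : k%:R - m%:R != 0 :> K.
  by rewrite -natrB ?pnatr_eq0 ?subn_eq0 -?ltnNge // ltnW.
apply: (mulfI nz); apply: (addIr (m%:R * \sum_(i < k.+1) i.+1%:R * a i * a (k - i)%N)).
rewrite a_rec // -[LHS](catalan_coef_rec c k m0); congr (_ + _ * _).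
apply: eq_bigr => i _; have := ltn_ord i; rewrite ltnS leq_eqVlt.
have a0 : a 0 = 0 by apply: a_lt.
case/predU1P => [-> | lt_ik].
  by rewrite subnn a0 catalan_coef0 !mulr0.
case: (posnP i) => [-> | i_gt0]; first by rewrite a0 catalan_coef0 mulr0 !mul0r.
by rewrite !IHk //; lia.
Qed.

End CatalanSeries.

(** * Polynomials modulo a power of X *)

Section TruncatedPolynomials.
Variable K : fieldType.
Implicit Types (p q r : {poly K}) (k m : nat).

Lemma dvdXnP m p : reflect (forall k, (k < m)%N -> p`_k = 0) ('X^m %| p).
Proof.
apply: (iffP idP) => [/dvdpP[q ->] k lt_km | p_low]; first by rewrite coefMXn lt_km.
apply/dvdpP; exists (drop_poly m p); rewrite -[LHS](poly_take_drop m).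
rewrite [take_poly m p](_ : _ = 0) ?add0r //; apply/polyP => k.
by rewrite coef_take_poly coef0; case: ifP => // /p_low.
Qed.

(** The tool for computing modulo a power of X: each use subtracts a multiple of a known congruence,
    until [ring] shows that the remainder is 0. *)
Lemma dvdp_combl d p q r : d %| p -> d %| q - r * p -> d %| q.
Proof. by move=> dp dq; rewrite -(subrK (r * p) q) dvdp_add // dvdp_mull. Qed.

Lemma dvdXnM_le m k p : (k <= m)%N -> 'X^m %| p -> 'X^k %| p.
Proof. by move=> le_km; apply: dvdp_trans; rewrite dvdp_exp2l. Qed.

Lemma dvdXnD m k p : ('X^(k + m) %| 'X^k * p) = ('X^m %| p).
Proof. by rewrite exprD dvdp_mul2l // expf_neq0 ?polyX_eq0. Qed.

Lemma dvdXnS m p : ('X^(m.+1) %| 'X * p) = ('X^m %| p).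
Proof. by rewrite -add1n -['X in RHS]expr1 dvdXnD. Qed.

Lemma coef_sum_scaleXn (a : nat -> K) m k :
  (\sum_(j < m) a j *: 'X^j)`_k = if (k < m)%N then a k else 0.
Proof. by rewrite -poly_def coef_poly. Qed.

Definition sigma p := p \Po (- 'X).

Lemma coef_sigma p k : (sigma p)`_k = (-1) ^+ k * p`_k.
Proof.
rewrite /sigma comp_polyE.
under eq_bigr => i _ do rewrite -mulN1r exprMn -polyCN -polyC_exp mul_polyC scalerA.
rewrite (coef_sum_scaleXn (fun i => p`_i * (-1) ^+ i)).
by case: ltnP => [_ | le_pk]; rewrite mulrC // nth_default ?mul0r.
Qed.

Lemma sigmaM p q : sigma (p * q) = sigma p * sigma q.
Proof. exact: comp_polyM. Qed.

Lemma sigmaC (c : K) : sigma c%:P = c%:P.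
Proof. exact: comp_polyC. Qed.

Lemma sigmaD p q : sigma (p + q) = sigma p + sigma q.
Proof. exact: comp_polyD. Qed.

Lemma sigmaX : sigma 'X = - 'X.
Proof. exact: comp_polyX. Qed.

Lemma dvdX_sub_sigma p : 'X %| p - sigma p.
Proof.
rewrite -['X]expr1; apply/dvdXnP => -[|] // _.
by rewrite coefB coef_sigma mul1r subrr.
Qed.

Definition twisted_der q h v p := q * p + h * 'X * p^`() + v * (p - sigma p).

(** * Algebraic rules for twisted derivations *)

Section TwistedDerivation.
Variables q h v : {poly K}.
Local Notation T := (twisted_der q h v).

Lemma twisted_derD p r : T (p + r) = T p + T r.
Proof. by rewrite /twisted_der derivD sigmaD; ring. Qed.

Lemma twisted_derC c p : T (c%:P * p) = c%:P * T p.
Proof. by rewrite /twisted_der derivM derivC sigmaM sigmaC; ring. Qed.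

Lemma twisted_derN p : T (- p) = - T p.
Proof. by rewrite -mulN1r -polyCN twisted_derC polyCN mulN1r. Qed.

Lemma twisted_derB p r : T (p - r) = T p - T r.
Proof. by rewrite twisted_derD twisted_derN. Qed.

(** The defect 2h comes from X (X^2)' = 2 X^2; the term with [sigma] contributes none because X^2 is
    even. *)
Lemma twisted_derX2 p : T ('X ^+ 2 * p) = 'X ^+ 2 * (T p + 2 * h * p).
Proof.
rewrite /twisted_der sigmaM expr2 !(sigmaM, derivM, derivX) sigmaX.
ring.
Qed.

Lemma twisted_der_dvd m p : 'X^m %| p -> 'X^m %| T p.
Proof.
move=> dp.
have dXp : 'X^m %| 'X * p^`().
  case: m dp => [|m] dp; first by rewrite dvd1p.
  rewrite exprS dvdp_mul2l ?polyX_eq0 //; case/dvdpP: dp => r ->.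
  rewrite derivM derivXn /= dvdp_add //; first by rewrite exprS mulrA dvdp_mull.
  by rewrite -mulr_natr mulrCA dvdp_mulr.
have dps : 'X^m %| p - sigma p.
  apply/dvdXnP => k lt_km; rewrite coefB coef_sigma.
  by move/dvdXnP/(_ k lt_km): dp => ->; rewrite mulr0 subrr.
rewrite /twisted_der -[h * _ * _]mulrA.
by apply: dvdp_add; [apply: dvdp_add|]; apply: dvdp_mull.
Qed.

End TwistedDerivation.

(** * Twisted derivations against multiplication by phi *)

Section PrederivationEquation.
Variables (N : nat) (a b : K) (phi v : {poly K}).
Let h := a%:P + (b - a)%:P * phi.
Let T := twisted_der b%:P h v.

Definition pre_eqn := h * ('X * phi^`() + phi) - b%:P * phi.

Hypothesis eqn1 : 'X^(N.+1) %| pre_eqn + v * (phi - sigma phi).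
Hypothesis eqn2 : 'X^(N.+1) %| 'X * (v * (phi - sigma phi)).

(** With D = phi - sigma phi, the defect is exactly (G + v D) p - v D (p - sigma p). The first term
    falls to [eqn1], the second to [eqn2], because X divides p - sigma p. *)
Lemma twisted_der_phi p :
  'X^(N.+1) %| T (phi * p) - phi * T p - (b%:P - h) * phi * p.
Proof.
have -> : T (phi * p) - phi * T p - (b%:P - h) * phi * p =
    (pre_eqn + v * (phi - sigma phi)) * p
    - v * (phi - sigma phi) * (p - sigma p).
  by rewrite /T /twisted_der sigmaM derivM /pre_eqn; ring.
apply: dvdp_sub; first exact: dvdp_mulr.
have /dvdpP[r ->] := dvdX_sub_sigma p.
rewrite [v * _ * _](_ : _ = r * ('X * (v * (phi - sigma phi)))); last by ring.
by rewrite dvdp_mull.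
Qed.

Let mu (c d : K) := c%:P + d%:P * phi.

Lemma twisted_der_mu c d p :
  'X^(N.+1) %| T (mu c d * p) - mu c d * T p - d%:P * (b%:P - h) * phi * p.
Proof.
have -> : T (mu c d * p) - mu c d * T p - d%:P * (b%:P - h) * phi * p =
   d%:P * (T (phi * p) - phi * T p - (b%:P - h) * phi * p).
  rewrite /mu mulrDl -(mulrA d%:P) /T twisted_derD !twisted_derC; ring.
by rewrite dvdp_mull // twisted_der_phi.
Qed.

(** The pre-derivation identity in polynomial coordinates. The 2h of [twisted_derX2] is shared
    between the two factors: h [mu c d] plus the defect of [twisted_der_mu] is
    [c%:P * h + (d * b)%:P * phi]. *)
Lemma twisted_der_mu2 c d c' d' p :
  'X^(N.+3) %| T ('X ^+ 2 * mu c d * mu c' d' * p)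
     - 'X ^+ 2 * ((c%:P * h + (d * b)%:P * phi) * mu c' d' * p
                  + mu c d * (c'%:P * h + (d' * b)%:P * phi) * p
                  + mu c d * mu c' d' * T p).
Proof.
rewrite -!(mulrA ('X ^+ 2)) /T twisted_derX2 -/T -mulrBr.
rewrite (dvdXnD N.+1 2).
have D1 := twisted_der_mu c d (mu c' d' * p).
have D2 := twisted_der_mu c' d' p.
apply: (dvdp_combl (r := 1) D1); apply: (dvdp_combl (r := mu c d) D2).
rewrite [X in _ %| X](_ : _ = 0) ?dvdp0 //.
by rewrite /mu !polyCM -!mulrA; set U := T (_ * _); ring.
Qed.

End PrederivationEquation.
(* A linear map with Q(X^2 p) = X^2 (Q p + 2 h p) is determined by Q 1 and
   Q X; the free parameter Q X is absorbed in v. *)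
Lemma twisted_der_of_X2 (Q : {poly K} -> {poly K}) m h r : 2 != 0 :> K ->
  (forall c p q, Q (c%:P * p + q) = c%:P * Q p + Q q) ->
  (forall p, 'X^m %| Q ('X ^+ 2 * p) - 'X ^+ 2 * (Q p + 2 * h * p)) ->
  'X^m %| Q 'X - 'X * r ->
  exists v, forall p, 'X^m %| Q p - twisted_der (Q 1) h v p.
Proof.
(* As X - sigma X = 2 X, the twisted derivation sends X to X (Q 1 + h + 2 v); this is to be X r. *)
move=> nz2 Qlin QX2 QX; exists (2^-1%:P * (r - Q 1 - h)); set v := _ * _.
have v2 : 2 * v = r - Q 1 - h.
  by rewrite /v mulrA -[2 in LHS]polyC_natr -polyCM divff // mul1r.
pose D p := Q p - twisted_der (Q 1) h v p.
(* The recursion advances by X^2, so the induction carries s and X s together. *)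
suff DD s : 'X^m %| D s /\ 'X^m %| D ('X * s) by move=> p; case: (DD p).
have Dlin c p q : D (c%:P * p + q) = c%:P * D p + D q.
  by rewrite /D Qlin twisted_derD twisted_derC; ring.
have D1 : D 1 = 0.
  by rewrite /D /twisted_der derivC -polyC1 sigmaC; ring.
have DX : 'X^m %| D 'X.
  apply: (dvdp_combl (r := 1) QX); rewrite [X in _ %| X](_ : _ = 0) ?dvdp0 //.
  rewrite /D /twisted_der derivX sigmaX opprK -mulr2n.
  transitivity ('X * (r - Q 1 - h - 2 * v)); first by ring.
  by rewrite v2 subrr mulr0.
have DX2 q : 'X^m %| D q -> 'X^m %| D ('X ^+ 2 * q).
  move=> Dq; apply: (dvdp_combl (r := 1) (QX2 q)).
  apply: (dvdp_combl (r := 'X ^+ 2) Dq).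
  rewrite [X in _ %| X](_ : _ = 0) ?dvdp0 //.
  by rewrite /D twisted_derX2; ring.
elim/poly_ind: s => [|p c [IH1 IH2]].
  have D0 : D 0 = 0.
    by have := Dlin (-1) 0 0; rewrite mulr0 addr0 polyCN mulN1r addNr.
  by rewrite mulr0 D0 dvdp0.
split.
  have -> : p * 'X + c%:P = c%:P * 1 + 'X * p by ring.
  by rewrite Dlin D1 mulr0 add0r.
have -> : 'X * (p * 'X + c%:P) = c%:P * 'X + 'X ^+ 2 * p by ring.
by rewrite Dlin dvdp_add ?dvdp_mull ?DX2.
Qed.

End TruncatedPolynomials.

(** * Pre-derivations of F1 in polynomial coordinates *)

Section Coordinates.
Variables (K : fieldType) (N : nat).
Local Notation V := 'rV[K]_N.+4.
Implicit Types (v w x y z : V) (p q : {poly K}) (a : K).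

Definition coord1 v := v 0 0.
Definition coord2 v := v 0 (lift ord0 ord0).
(* d = e_1 - e_2 is killed, so e_1 and e_2 both go to 1; truncated subtraction
   makes j.-1 the right exponent for both.  The vector mkvec a p is a d + p. *)
Definition pol v : {poly K} := \sum_(j < N.+4) v 0 j *: 'X^(j.-1).
Definition mkvec a p : V :=
  \row_(j < N.+4) (if j == 0%N :> nat then a
                   else if j == 1%N :> nat then p`_0 - a else p`_(j.-1)).

Lemma pol_linear : linear pol.
Proof.
move=> a v w; rewrite /pol scaler_sumr -big_split; apply: eq_bigr => j _.
by rewrite !mxE scalerA scalerDl.
Qed.
HB.instance Definition _ :=
  GRing.isLinear.Build K V {poly K} *:%R pol pol_linear.

Lemma coord1_linear : linear_for *%R coord1.
Proof. by move=> a v w; rewrite /coord1 !mxE. Qed.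
HB.instance Definition _ := GRing.isLinear.Build K V K *%R coord1 coord1_linear.

Lemma mkvec_linear a a' b p q :
  mkvec (b * a + a') (b *: p + q) = b *: mkvec a p + mkvec a' q.
Proof.
apply/rowP => j; rewrite !mxE; case: eqP => // _; case: eqP => _; rewrite !coefE //.
by ring.
Qed.

Lemma pol_mkvec a p : pol (mkvec a p) = take_poly N.+3 p.
Proof.
rewrite /pol 2!big_ord_recl /= !mxE /= addrA -scalerDl subrKC.
apply/polyP => k; rewrite coefD coefZ coefXn coef_take_poly.
rewrite (_ : \sum_(j < N.+2) _ = 'X * \sum_(j < N.+2) p`_j.+1 *: 'X^j); last first.
  rewrite mulr_sumr; apply: eq_bigr => j _.
  by rewrite mxE /= /bump !add1n /= -scalerAr -exprS.
rewrite coefXM (coef_sum_scaleXn (fun j => p`_j.+1)).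
by case: k => [|k]; rewrite ?mulr1 ?addr0 // mulr0 add0r.
Qed.

Lemma coord1_mkvec a p : coord1 (mkvec a p) = a.
Proof. by rewrite /coord1 mxE. Qed.

Lemma coord2_mkvec a p : coord2 (mkvec a p) = p`_0 - a.
Proof. by rewrite /coord2 mxE. Qed.

Lemma pol_coef0 v : (pol v)`_0 = coord1 v + coord2 v.
Proof.
rewrite /pol 2!big_ord_recl /= !coefD !coefZ !coefXn !mulr1 addrA.
rewrite coef_sum big1 ?addr0 // => j _.
by rewrite coefZ coefXn /= mulr0.
Qed.

Lemma pol_coefS v (k : nat) (lt_k : (k.+2 < N.+4)%N) :
  (pol v)`_k.+1 = v 0 (Ordinal lt_k).
Proof.
rewrite /pol coef_sum (bigD1 (Ordinal lt_k)) //= coefZ coefXn eqxx mulr1.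
rewrite big1 ?addr0 // => j ne_j; rewrite coefZ coefXn.
case: eqP => [Ej|_]; last by rewrite mulr0.
by case/eqP: ne_j; apply: val_inj => /=; lia.
Qed.

Lemma pol_mkvecK v : mkvec (coord1 v) (pol v) = v.
Proof.
apply/rowP => -[[|[|j]] lt_j]; rewrite mxE /=.
- by congr (v _ _); apply: val_inj.
- rewrite pol_coef0 addrC addKr; by congr (v _ _); apply: val_inj.
by rewrite pol_coefS.
Qed.

Lemma eq_mkvec a p q : 'X^(N.+3) %| p - q -> mkvec a p = mkvec a q.
Proof.
move/dvdXnP => E; have E' k : (k < N.+3)%N -> p`_k = q`_k.
  by move=> /E; rewrite coefB => /eqP; rewrite subr_eq0 => /eqP.
apply/rowP => -[[|[|j]] lt_j]; rewrite !mxE //= E' //.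
Qed.

Lemma pol_mkvec_dvd a p : 'X^(N.+3) %| pol (mkvec a p) - p.
Proof.
apply/dvdXnP => k lt_k.
by rewrite pol_mkvec coefB coef_take_poly lt_k subrr.
Qed.

Variables (alpha : nat -> K) (theta : K).

Definition phi : {poly K} := 'X * \poly_(k < N.+1) alpha (k + 4)%N.
Definition mu (c d : K) : {poly K} := c%:P + d%:P * phi.

Lemma coef_phi k : (k < N.+2)%N -> phi`_k = if k == 0%N then 0 else alpha (k + 3)%N.
Proof.
by case: k => [|k] lt_k; rewrite coefXM //= coef_poly ifT // -addSnnS.
Qed.

Lemma pol_basis i : (0 < i <= N.+4)%N -> pol (F1_basis K N.+4 i) = 'X^(i - 2).
Proof.
case: i => // i /= lt_i; rewrite /pol (bigD1 (Ordinal lt_i)) //= mxE eqxx scale1r.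
rewrite big1 ?addr0; first by congr ('X ^+ _); lia.
move=> j ne_j; rewrite mxE eqSS.
by rewrite (negPf ne_j : (_ == i) = _) scale0r.
Qed.

Lemma coord1_basis i : coord1 (F1_basis K N.+4 i) = (i == 1%N)%:R.
Proof. by rewrite /coord1 mxE /= eq_sym. Qed.

(** * The brackets in polynomial coordinates *)

Local Notation mul := (F1_mul N.+4 alpha theta).
Local Notation br := (@F1_bracket K N.+4 alpha theta).

Lemma coord1_mul i j : coord1 (mul i j) = 0.
Proof.
have e0 k : (1 < k)%N -> coord1 (F1_basis K N.+4 k) = 0.
  by move=> k1; rewrite coord1_basis gtn_eqF.
rewrite /F1_mul; case: ifP => _; first by rewrite e0.
case: ifP => [/andP[/andP[i1 _] _]|_]; first by rewrite e0 // ltnW.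
case: ifP => _.
  rewrite linearD linearZ /= e0 // mulr0 addr0 linear_sum /= big_nat big1 // => t.
  by case/andP => t4 _; rewrite linearZ /= e0 ?mulr0 //; lia.
case: ifP => [/andP[/andP[i1 _] _]|_]; last by rewrite linear0.
rewrite linear_sum /= big_nat big1 // => t.
by case/andP => t4 _; rewrite linearZ /= e0 ?mulr0 //; lia.
Qed.

Lemma coord1_br x y : coord1 (br x y) = 0.
Proof.
rewrite /F1_bracket linear_sum big1 // => i _; rewrite linear_sum big1 // => j _.
by rewrite linearZ /= coord1_mul mulr0.
Qed.

Lemma phiE : 'X * phi = \sum_(4 <= t < N.+4.+1) alpha t *: 'X^(t - 2).
Proof.
rewrite /phi poly_def mulrA mulr_sumr -(big_mkord xpredT (fun i => _ * (alpha (i + 4)%N *: 'X^i))).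
rewrite -[4%N]add0n big_addn (_ : (N.+4.+1 - 4 = N.+1)%N) //.
apply: eq_bigr => i _; rewrite -scalerAr -expr2 -exprD; congr (_ *: 'X ^+ _); lia.
Qed.

Lemma pol_mul1 i : (0 < i <= N.+4)%N ->
  'X^(N.+3) %| pol (mul i 1%N) - 'X * 'X^(i - 2).
Proof.
rewrite /F1_mul; case: i => [|[|i]] //= lt_i.
  by rewrite pol_basis //= expr1 expr0 mulr1 subrr dvdp0.
rewrite !andbT andbF; case: leqP => lt2; last first.
  by rewrite pol_basis ?lt2 //= -exprS [(i.+3 - 2)%N](_ : _ = (i.+2 - 2).+1) ?subrr ?dvdp0; lia.
have -> : i = N.+2 by lia.
by rewrite /= linear0 sub0r dvdpNr -exprS.
Qed.

Lemma dvdp_sum_nat (d : {poly K}) m k (F : nat -> {poly K}) :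
  (forall t, (m <= t < k)%N -> d %| F t) -> d %| \sum_(m <= t < k) F t.
Proof.
move=> dF; rewrite big_nat_cond; elim/big_ind: _ => [|p q dp dq|t].
- exact: dvdp0.
- exact: dvdp_add.
by rewrite andbT; apply: dF.
Qed.

(** Only [e_1, e_2] deviates from multiplication by X phi: its top coefficient is [theta] where the
    polynomial has alpha_n. *)
Lemma pol_mul2 i : (0 < i <= N.+4)%N ->
  'X^(N.+3) %| pol (mul i 2%N) - 'X * phi * 'X^(i - 2)
               - ((i == 1%N)%:R * (theta - alpha N.+4))%:P * 'X^(N.+2).
Proof.
rewrite /F1_mul; case: i => [|[|i]] //= lt_i.
  rewrite linearD linearZ /= pol_basis ?leqnn // linear_sum /=.
  have -> : 'X * phi = \sum_(4 <= t < N.+4) alpha t *: 'X^(t - 2)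
                       + alpha N.+4 *: 'X^(N.+2).
    by rewrite phiE big_nat_recr //= -addnBA.
  rewrite (_ : (1 - 2)%N = 0%N) // expr0 mulr1 mul1r.
  rewrite (eq_big_nat _ _ (F2 := fun t => alpha t *: 'X^(t - 2))); last first.
    by move=> t lt_t; rewrite linearZ /= pol_basis //; lia.
  rewrite [(N.+4 - 2)%N](_ : _ = N.+2); last lia.
  rewrite polyCB -!mul_polyC [X in _ %| X](_ : _ = 0) ?dvdp0 //; ring.
rewrite !andbF !andbT mul0r polyC0 mul0r subr0.
set F := fun t => alpha t *: 'X^(t - 2 + i).
have -> : 'X * phi * 'X^(i.+2 - 2) = \sum_(4 <= t < N.+4.+1) F t.
  rewrite phiE mulr_suml; apply: eq_bigr => t _.
  by rewrite /F -scalerAl -exprD; congr (_ *: 'X ^+ _); lia.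
(* The bracket stops at e_n while the product of polynomials goes further; the excess terms vanish
   modulo ['X^(N.+3)]. *)
have dF t : (N.+3 <= t - 2 + i)%N -> 'X^(N.+3) %| F t.
  by move=> le_t; rewrite /F -mul_polyC dvdp_mull // dvdp_exp2l.
case: leqP => le_i2.
  rewrite linear0 sub0r dvdpNr; apply: dvdp_sum_nat => t /andP[le4t _]; apply: dF.
  by move: le_i2; lia.
rewrite linear_sum /= (_ : (i.+2 + 2 = 4 + i)%N); last lia.
rewrite big_addn [\sum_(4 <= t < N.+4.+1) F t](big_cat_nat (n := (N.+4.+1 - i)%N)) //=; [|lia..].
rewrite (eq_big_nat _ _ (F2 := F)) => [|t lt_t].
  rewrite opprD addrA subrr sub0r dvdpNr; apply: dvdp_sum_nat => t lt_t.
  by apply: dF; lia.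
rewrite linearZ /= pol_basis /F; last lia.
by congr (alpha _ *: 'X ^+ _); lia.
Qed.

Lemma mul_gt2 i j : (2 < j)%N -> mul i j = 0.
Proof. by case: j => [|[|[|j]]] //= _; rewrite /F1_mul /= !andbF. Qed.

Local Notation delta := (theta - alpha N.+4).

Lemma pol_br x y :
  'X^(N.+3) %| pol (br x y) - 'X * mu (coord1 y) (coord2 y) * pol x
               - (coord1 x * coord2 y * delta)%:P * 'X^(N.+2).
Proof.
have dsum (d : {poly K}) (F : 'I_N.+4 -> {poly K}) :
    (forall i, d %| F i) -> d %| \sum_(i < N.+4) F i.
  move=> dF; elim/big_ind: _ => [|p q dp dq|i _]; [exact: dvdp0|exact: dvdp_add|exact: dF].
pose D1 (i : nat) := pol (mul i.+1 1%N) - 'X * 'X^(i.+1 - 2).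
pose D2 (i : nat) := pol (mul i.+1 2%N) - 'X * phi * 'X^(i.+1 - 2)
               - ((i.+1 == 1%N)%:R * (theta - alpha N.+4))%:P * 'X^(N.+2).
rewrite (_ : _ - _ = \sum_(i < N.+4) (x 0 i)%:P *
    ((coord1 y)%:P * D1 i + (coord2 y)%:P * D2 i)).
  apply: dsum => i; rewrite dvdp_mull // dvdp_add // dvdp_mull //.
    by apply: pol_mul1 => /=.
  by apply: pol_mul2 => /=.
have -> : pol (br x y) = \sum_(i < N.+4) (x 0 i)%:P *
   ((coord1 y)%:P * pol (mul i.+1 1%N) + (coord2 y)%:P * pol (mul i.+1 2%N)).
  rewrite /F1_bracket linear_sum; apply: eq_bigr => i _.
  rewrite 2!big_ord_recl big1 => [|j _]; last by rewrite mul_gt2 ?scaler0.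
  rewrite addr0 linearD !linearZ /= -!mul_polyC !polyCM; ring.
have -> : (coord1 x * coord2 y * delta)%:P * 'X^(N.+2) =
  \sum_(i < N.+4) (x 0 i)%:P * ((coord2 y)%:P *
     (((i.+1 == 1%N)%:R * delta)%:P * 'X^(N.+2))).
  rewrite big_ord_recl big1 => [|j _].
    by rewrite /= mul1r addr0 !polyCM /coord1; ring.
  by rewrite mul0r mul0r !mulr0.
have -> : 'X * mu (coord1 y) (coord2 y) * pol x = \sum_(i < N.+4) (x 0 i)%:P *
   ((coord1 y)%:P * ('X * 'X^(i.+1 - 2)) + (coord2 y)%:P * ('X * phi * 'X^(i.+1 - 2))).
  rewrite /pol mulr_sumr; apply: eq_bigr => i _.
  rewrite (_ : (i.+1 - 2 = i.-1)%N); last lia.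
  by rewrite -mul_polyC /mu; ring.
rewrite -!sumrB; apply: eq_bigr => i _; rewrite /D1 /D2; ring.
Qed.

(** Double brackets do not see [theta]: the error of the inner bracket is a multiple of X^(N+2),
    killed by the next factor X, and the outer one makes no error because [br x y] has first
    coordinate 0. *)
Lemma pol_br2 x y z :
  'X^(N.+3) %| pol (br (br x y) z)
     - 'X ^+ 2 * mu (coord1 y) (coord2 y) * mu (coord1 z) (coord2 z) * pol x.
Proof.
have D1 := pol_br x y; have D2 := pol_br (br x y) z.
rewrite coord1_br !mul0r subr0 in D2.
apply: (dvdp_combl (r := 1) D2).
apply: (dvdp_combl (r := 'X * mu (coord1 z) (coord2 z)) D1).
set c := (_)%:P in D1 *; set u := mu _ _; set w := mu _ _.
rewrite [X in _ %| X](_ : _ = w * c * 'X^(N.+3)) ?dvdp_mulIr //.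
rewrite [RHS](_ : _ = w * c * ('X * 'X^(N.+2))); last by rewrite -exprS.
by ring.
Qed.

Hypothesis n_gt4 : (4 < N.+4)%N.
Local Notation L := (F1 n_gt4 alpha theta).

(** * Constructing pre-derivations from solutions of the congruences *)

Section BuildPrederivation.
Variables (a b : K) (v : {poly K}).
Let h := a%:P + (b - a)%:P * phi.
Let T := twisted_der b%:P h v.

Definition pre_map (w : L) : L := mkvec (a * coord1 w) (T (pol w)).

Lemma pre_map_linear : linear pre_map.
Proof.
move=> c w w'; rewrite /pre_map linearP /= linearP /= /T twisted_derD -mul_polyC.
by rewrite twisted_derC mulrDr mulrCA mul_polyC mkvec_linear.
Qed.
HB.instance Definition _ := GRing.isLinear.Build K L L *:%R pre_map pre_map_linear.

Hypothesis eqn1 : 'X^(N.+1) %| pre_eqn a b phi + v * (phi - sigma phi).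
Hypothesis eqn2 : 'X^(N.+1) %| 'X * (v * (phi - sigma phi)).

Lemma pre_map_prederivation : prederivation (pre_map : {linear L -> L}).
Proof.
move=> x y z.
(* Neither h X p' nor v (p - sigma p) has a constant term, so [T] multiplies constant terms by b.
   The result is the factor occurring in [twisted_der_mu2]. *)
have muE w : mu (coord1 (pre_map w)) (coord2 (pre_map w))
    = (coord1 w)%:P * h + (coord2 w * b)%:P * phi.
  rewrite /pre_map coord1_mkvec coord2_mkvec.
  have -> : (T (pol w))`_0 = b * (coord1 w + coord2 w).
    rewrite /T /twisted_der !coefD -pol_coef0 -mulrA [h * _]mulrC -[_ * _ * h]mulrA.
    rewrite coefXM eqxx addr0 mul_polyC coefZ !coef0M coefB coef_sigma expr0 mul1r subrr.
    by rewrite mulr0 addr0.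
  by rewrite /mu /h !(polyCM, polyCB, polyCD); ring.
set lhs := LHS; set rhs := RHS.
have lhsE : lhs = mkvec 0 (T (pol (br (br x y) z))).
  by rewrite /lhs /= /pre_map /= coord1_br mulr0.
have rhsE : rhs = mkvec 0 (pol rhs).
  rewrite -[LHS]pol_mkvecK; congr (mkvec _ _).
  by rewrite /rhs /= !linearD /= !coord1_br !addr0.
rewrite lhsE rhsE; apply: eq_mkvec.
have -> : pol rhs = pol (br (br (pre_map x) y) z) + pol (br (br x (pre_map y)) z)
   + pol (br (br x y) (pre_map z)) by rewrite /rhs !linearD.
have D0 := twisted_der_dvd b%:P h v (pol_br2 x y z).
rewrite twisted_derB -/T in D0.
have D1 := pol_br2 (pre_map x) y z.
have D1' := pol_mkvec_dvd (a * coord1 x) (T (pol x)).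
rewrite -/(pre_map x) in D1'.
have D2 := pol_br2 x (pre_map y) z.
have D3 := pol_br2 x y (pre_map z).
rewrite muE in D2; rewrite muE in D3.
have D4 := twisted_der_mu2 eqn1 eqn2 (coord1 y) (coord2 y) (coord1 z) (coord2 z) (pol x).
rewrite -/T -/h in D4.
apply: (dvdp_combl (r := 1) D0); apply: (dvdp_combl (r := - 1) D1).
apply: (dvdp_combl (r := - 1) D2); apply: (dvdp_combl (r := - 1) D3).
apply: (dvdp_combl (r := 1) D4).
apply: (dvdp_combl (r := - 'X ^+ 2 * mu (coord1 y) (coord2 y) * mu (coord1 z) (coord2 z)) D1').
rewrite [X in _ %| X](_ : _ = 0) ?dvdp0 //.
rewrite -/(mu (coord1 y) (coord2 y)) -/(mu (coord1 z) (coord2 z)).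
by ring.
Qed.

End BuildPrederivation.

Lemma eigen_not_nilpotent (P : {linear L -> L}) (w : L) (c : K) :
  c != 0 -> w != 0 -> P w = c *: w -> ~ nilpotent_map P.
Proof.
move=> c0 w0 Pw [k /(_ w)].
have -> : iter k P w = c ^+ k *: w.
  by elim: k => [|k IHk]; rewrite ?scale1r // iterS IHk linearZ /= Pw scalerA exprSr.
by move/eqP; rewrite scaler_eq0 expf_eq0 (negPf c0) andbF (negPf w0).
Qed.

Lemma vec_eq0 (w : L) : coord1 w = 0 -> 'X^(N.+3) %| pol w -> w = 0.
Proof.
move=> w1 dw; rewrite -[w]pol_mkvecK w1 (@eq_mkvec _ _ 0) ?subr0 //.
by apply/rowP => j; rewrite !mxE !coef0 subr0 !if_same.
Qed.

Lemma pol_mkvec_id a p : (size p <= N.+3)%N -> pol (mkvec a p) = p.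
Proof. by move=> lep; rewrite pol_mkvec take_poly_id. Qed.

Lemma mkvec_split a p : mkvec a p = a *: mkvec 1 0 + mkvec 0 p.
Proof. by rewrite -mkvec_linear mulr1 addr0 scaler0 add0r. Qed.

(** * The shape of an arbitrary pre-derivation *)

Section Prederivation.
Hypothesis two_neq0 : 2 != 0 :> K.
Hypothesis phi_not_even : ~~ ('X^(N.+1) %| phi - sigma phi).
Variable P : {linear L -> L}.
Hypothesis preP : prederivation P.

Lemma phi_coef0 : phi`_0 = 0.
Proof. by rewrite coefXM. Qed.

Lemma phi_neq0 : ~~ ('X^(N.+1) %| phi).
Proof.
apply: contraNN phi_not_even => d; rewrite dvdp_sub //.
by apply/dvdXnP => k lt_k; rewrite coef_sigma (dvdXnP _ _ d) ?mulr0.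
Qed.

Lemma pol_pre x y z : 'X^(N.+3) %| pol (P (br (br x y) z))
  - 'X ^+ 2 * (mu (coord1 y) (coord2 y) * mu (coord1 z) (coord2 z) * pol (P x)
     + (mu (coord1 (P y)) (coord2 (P y)) * mu (coord1 z) (coord2 z)
     + mu (coord1 y) (coord2 y) * mu (coord1 (P z)) (coord2 (P z))) * pol x).
Proof.
have -> : pol (P (br (br x y) z)) = pol (br (br (P x) y) z)
    + pol (br (br x (P y)) z) + pol (br (br x y) (P z)).
  by rewrite -!linearD; congr (pol _); exact: preP.
apply: (dvdp_combl (r := 1) (pol_br2 (P x) y z)).
apply: (dvdp_combl (r := 1) (pol_br2 x (P y) z)).
apply: (dvdp_combl (r := 1) (pol_br2 x y (P z))).
by rewrite [X in _ %| X](_ : _ = 0) ?dvdp0 //; ring.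
Qed.

Lemma pol_mkvec01 : pol (mkvec 0 1) = 1.
Proof. by rewrite pol_mkvec_id // size_poly1. Qed.

(** Such a y multiplies everything to 0 in double brackets. The identity for [[e_2, y], e_1] then
    makes the multiplier of P y vanish modulo X^(N+1), and 1 and phi are independent there. *)
Lemma pre_coords0 y : coord1 y = 0 -> coord2 y = 0 ->
  coord1 (P y) = 0 /\ coord2 (P y) = 0.
Proof.
move=> y1 y2; have mu0 : mu 0 0 = 0 by rewrite /mu polyC0 mul0r addr0.
have mu10 : mu 1 0 = 1 by rewrite /mu polyC0 mul0r addr0.
have D := pol_pre (mkvec 0 1) y (mkvec 1 1).
have Ez : br (br (mkvec 0 1) y) (mkvec 1 1) = 0.
  apply: vec_eq0; first exact: coord1_br.
  have := pol_br2 (mkvec 0 1) y (mkvec 1 1).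
  by rewrite y1 y2 mu0 mulr0 !mul0r subr0.
move: D; rewrite Ez !linear0 y1 y2 mu0 !mul0r add0r addr0.
rewrite coord1_mkvec coord2_mkvec coefC subrr mu10 mulr1 pol_mkvec01 mulr1.
rewrite dvdpNr add0r (dvdXnD N.+1 2) => D.
have c1 : coord1 (P y) = 0.
  have := dvdXnP _ _ D 0%N isT.
  by rewrite coefD coefC mul_polyC coefZ phi_coef0 mulr0 addr0.
split=> //; apply/eqP; apply: contraNT phi_neq0 => nz.
by move: D; rewrite /mu c1 polyC0 add0r mul_polyC dvdpZr.
Qed.

(** Here [mkvec 0 1] is e_2, [mkvec 1 1] is e_1 and [mkvec 1 0] is d. Once [lambda] is shown to be
    0, [u] and [b] are the scalars a and b of the twisted derivation. *)
Let Q p := pol (P (mkvec 0 p)).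
Let lambda := coord1 (P (mkvec 0 1)).
Let u := coord1 (P (mkvec 1 0)).
Let b := (Q 1)`_0.
Let h := mu (u + lambda) (b - u - lambda).

Lemma pre_poly_linear c p q : Q (c%:P * p + q) = c%:P * Q p + Q q.
Proof.
by rewrite /Q !mul_polyC -[0 in LHS]addr0 -{1}[0](mulr0 c) mkvec_linear !linearP.
Qed.

Lemma pre_poly p y z : 'X^(N.+3) %|
  Q ('X ^+ 2 * (mu (coord1 y) (coord2 y) * mu (coord1 z) (coord2 z) * p))
  - 'X ^+ 2 * (mu (coord1 y) (coord2 y) * mu (coord1 z) (coord2 z) * Q p
     + (mu (coord1 (P y)) (coord2 (P y)) * mu (coord1 z) (coord2 z)
     + mu (coord1 y) (coord2 y) * mu (coord1 (P z)) (coord2 (P z))) * p).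
Proof.
have D := pol_pre (mkvec 0 p) y z.
have E : br (br (mkvec 0 p) y) z = mkvec 0
   ('X ^+ 2 * (mu (coord1 y) (coord2 y) * mu (coord1 z) (coord2 z) * p)).
  rewrite -[LHS]pol_mkvecK coord1_br; apply: eq_mkvec.
  apply: (dvdp_combl (r := 1) (pol_br2 (mkvec 0 p) y z)).
  apply: (dvdp_combl (r := 'X ^+ 2 * (mu (coord1 y) (coord2 y)
     * mu (coord1 z) (coord2 z))) (pol_mkvec_dvd 0 p)).
  by rewrite [X in _ %| X](_ : _ = 0) ?dvdp0 //; ring.
rewrite E -/(Q _) -/(Q p) in D.
apply: (dvdp_combl (r := 1) D).
apply: (dvdp_combl (r := 'X ^+ 2 * (mu (coord1 (P y)) (coord2 (P y)) * mu (coord1 z) (coord2 z)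
     + mu (coord1 y) (coord2 y) * mu (coord1 (P z)) (coord2 (P z)))) (pol_mkvec_dvd 0 p)).
by rewrite [X in _ %| X](_ : _ = 0) ?dvdp0 //; ring.
Qed.

(** From [[d, e_1], e_1] = 0, X^2 kills the polynomial of P d, whose constant term is the sum of the
    two coordinates. *)
Lemma coord2_pre_d : coord2 (P (mkvec 1 0)) = - u.
Proof.
have mu10 : mu 1 0 = 1 by rewrite /mu polyC0 mul0r addr0.
have := pol_pre (mkvec 1 0) (mkvec 1 1) (mkvec 1 1).
have pd : pol (mkvec 1 0) = 0 by rewrite pol_mkvec_id // size_poly0.
have -> : br (br (mkvec 1 0) (mkvec 1 1)) (mkvec 1 1) = 0.
  apply: vec_eq0; first exact: coord1_br.
  have := pol_br2 (mkvec 1 0) (mkvec 1 1) (mkvec 1 1).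
  by rewrite pd mulr0 subr0.
rewrite coord1_mkvec coord2_mkvec coefC subrr mu10 pd mulr0 addr0 !mul1r !linear0.
rewrite sub0r dvdpNr (dvdXnD N.+1 2) => /dvdXnP/(_ 0%N isT).
by rewrite pol_coef0 -/u => /eqP; rewrite addr_eq0 => /eqP ->; rewrite opprK.
Qed.

Lemma mu_pre_e2 : mu (coord1 (P (mkvec 0 1))) (coord2 (P (mkvec 0 1)))
  = mu lambda (b - lambda).
Proof. by rewrite -/lambda /b /Q pol_coef0 -/lambda addrAC subrr add0r. Qed.

Lemma mu_pre_e1 : mu (coord1 (P (mkvec 1 1))) (coord2 (P (mkvec 1 1))) = h.
Proof.
have coord2D x y : coord2 (x + y) = coord2 x + coord2 y by rewrite /coord2 mxE.
rewrite mkvec_split scale1r linearD linearD coord2D -/lambda -/u coord2_pre_d /h.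
congr (mu _ _); rewrite /b /Q pol_coef0 -/lambda; ring.
Qed.

Lemma mu_e1 : mu (coord1 (mkvec 1 1)) (coord2 (mkvec 1 1)) = 1.
Proof.
by rewrite coord1_mkvec coord2_mkvec coefC subrr /mu polyC0 mul0r addr0.
Qed.

Lemma mu_e2 : mu (coord1 (mkvec 0 1)) (coord2 (mkvec 0 1)) = phi.
Proof.
by rewrite coord1_mkvec coord2_mkvec coefC subr0 /mu polyC0 mul1r add0r.
Qed.

Lemma pre_poly_X2 p : 'X^(N.+3) %| Q ('X ^+ 2 * p) - 'X ^+ 2 * (Q p + 2 * h * p).
Proof.
have := pre_poly p (mkvec 1 1) (mkvec 1 1).
rewrite mu_e1 mu_pre_e1 !mul1r mulr1 => D; apply: (dvdp_combl (r := 1) D).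
by rewrite [X in _ %| X](_ : _ = 0) ?dvdp0 //; ring.
Qed.

Lemma pre_poly_phi p : 'X^(N.+1) %|
  Q (phi * p) + h * phi * p - phi * Q p - mu lambda (b - lambda) * p.
Proof.
have := pre_poly p (mkvec 1 1) (mkvec 0 1).
rewrite mu_e1 mu_e2 mu_pre_e1 mu_pre_e2 !mul1r => D.
rewrite -(dvdXnD N.+1 2); apply: (dvdp_combl (r := 1) D).
apply: (dvdp_combl (r := - 1) (pre_poly_X2 (phi * p))).
by rewrite [X in _ %| X](_ : _ = 0) ?dvdp0 //; ring.
Qed.

Lemma pre_poly_twisted :
  exists v : {poly K}, forall p, 'X^(N.+3) %| Q p - twisted_der (Q 1) h v p.
Proof.
(* The vector X has both coordinates 0, hence so has its image, which therefore has no constant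
   term. *)
have [r QX] : exists r, Q 'X = 'X * r.
  suff /dvdpP[r ->] : 'X %| Q 'X by exists r; rewrite mulrC.
  rewrite -['X in X in X %| _]expr1; apply/dvdXnP => -[|] // _.
  rewrite pol_coef0; have [||-> ->] := pre_coords0 (y := mkvec 0 'X); last exact: addr0.
    by rewrite coord1_mkvec.
  by rewrite coord2_mkvec coefX subrr.
apply: (twisted_der_of_X2 (r := r) two_neq0 pre_poly_linear pre_poly_X2).
by rewrite QX subrr dvdp0.
Qed.

Lemma pre_eqn_of_prederivation : nilpotent_map P \/
  exists c d : K, ((c != 0) || (d != 0)) /\ 'X^N %| pre_eqn c d phi.
Proof.
have [v QT] := pre_poly_twisted; set T := twisted_der _ _ _ in QT.
have le13 : (N.+1 <= N.+3)%N by lia.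
have QT1 p := dvdXnM_le le13 (QT p).
have T1 : T 1 = Q 1.
  by rewrite /T /twisted_der derivC -polyC1 sigmaC; ring.
have E p : 'X^(N.+1) %| T (phi * p) + h * phi * p - phi * T p - mu lambda (b - lambda) * p.
  apply: (dvdp_combl (r := 1) (pre_poly_phi p)).
  apply: (dvdp_combl (r := phi) (QT1 p)).
  apply: (dvdp_combl (r := -1) (QT1 (phi * p))).
  by rewrite [X in _ %| X](_ : _ = 0) ?dvdp0 //; ring.
(* Modulo X every other term of [E 1] vanishes, leaving the constant term [lambda]. *)
have lambda0 : lambda = 0.
  have := dvdXnP _ _ (E 1) 0%N isT.
  have d1 : 'X^1 %| phi by rewrite expr1 dvdp_mulIl.
  have dT : 'X^1 %| T (phi * 1) by rewrite twisted_der_dvd // mulr1.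
  suff /dvdXnP/(_ 0%N isT) : 'X^1 %| mu lambda (b - lambda).
    by rewrite coefD coefC mul_polyC coefZ phi_coef0 mulr0 addr0.
  apply: (dvdp_combl (r := -1) (dvdXnM_le (ltn0Sn N) (E 1))).
  rewrite [X in _ %| X](_ : _ = T (phi * 1) + (h - T 1) * phi); last by ring.
  by rewrite dvdp_add // dvdp_mull.
have hE : h = u%:P + (b - u)%:P * phi by rewrite /h /mu lambda0 addr0 subr0.
have E1 : 'X^(N.+1) %| pre_eqn u b phi + v * (phi - sigma phi).
  apply: (dvdp_combl (r := 1) (E 1)).
  rewrite [X in _ %| X](_ : _ = 0) ?dvdp0 //.
  rewrite mulr1 T1 /T /twisted_der /mu lambda0 polyC0 subr0 /pre_eqn -hE; ring.
have EX : 'X^(N.+1) %| 'X * (pre_eqn u b phi - v * (phi - sigma phi)).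
  apply: (dvdp_combl (r := 1) (E 'X)).
  rewrite [X in _ %| X](_ : _ = 0) ?dvdp0 //.
  rewrite /T /twisted_der /mu lambda0 polyC0 subr0 /pre_eqn -hE.
  rewrite derivM sigmaM sigmaX derivX; ring.
(* Adding [EX] to X times [E1] eliminates v and leaves 2 X G; cancelling X costs one power. *)
have EN : 'X^N %| pre_eqn u b phi.
  rewrite -dvdXnS -(dvdpZr _ _ two_neq0) -mul_polyC.
  apply: (dvdp_combl (r := 1) EX); apply: (dvdp_combl (r := 'X) E1).
  rewrite [X in _ %| X](_ : _ = 0) ?dvdp0 //.
  by rewrite polyC_natr; ring.
case: (boolP ((u != 0) || (b != 0))) => [nz | ]; first by right; exists u, b.
rewrite negb_or !negbK => /andP[/eqP u0 /eqP b0]; left.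
have h0 : h = 0 by rewrite hE u0 b0 subrr polyC0 mul0r addr0.
(* Now G = 0, so [E1] reads v D = 0; were v prime to X, D would vanish modulo X^(N+1), against
   [phi_not_even]. *)
have dv : 'X %| v.
  move: E1; rewrite /pre_eqn u0 b0 subrr polyC0 !(mul0r, addr0) subrr add0r.
  apply: contraTT => ndv; rewrite Gauss_dvdpr // coprimep_expl // coprimep_sym.
  by rewrite -['X]subr0 -polyC0 coprimep_XsubC -dvdp_XsubCl polyC0 subr0.
have dT j p : 'X^j %| p -> 'X^(j.+1) %| T p.
  move=> dp; rewrite /T /twisted_der h0 !mul0r addr0 exprS.
  have dq : 'X %| Q 1.
    by rewrite -['X]expr1; apply/dvdXnP => -[|] // _; exact: b0.
  apply: dvdp_add; first exact: dvdp_mul.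
  apply: dvdp_mul => //; apply: dvdp_sub => //.
  by apply/dvdXnP => k lt_k; rewrite coef_sigma (dvdXnP _ _ dp) ?mulr0.
have P1 w : coord1 (P w) = 0.
  rewrite -[w]pol_mkvecK mkvec_split; set p := pol w.
  have -> : mkvec 0 p = p`_0 *: mkvec 0 1 + mkvec 0 (p - (p`_0)%:P).
    by rewrite -mkvec_linear mulr0 addr0 -mul_polyC mulr1 addrC subrK.
  rewrite !linearD !linearZ /= -/u -/lambda u0 lambda0 !mulr0 !add0r.
  have [||->] // := pre_coords0 (y := mkvec 0 (p - (p`_0)%:P)).
    by rewrite coord1_mkvec.
  by rewrite coord2_mkvec coefB coefC subrr subr0.
(* One application removes the component along d, and each of the N + 3 others gains a power of
   X. *)
exists N.+4 => w.
have iterP j : exists2 p, iter j.+1 P w = mkvec 0 p & 'X^j %| p.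
  elim: j => [|j [p Ep dp]].
    by exists (pol (P w)); rewrite ?dvd1p // -[LHS]pol_mkvecK P1.
  exists (T p); last exact: dT.
  rewrite iterS Ep -[LHS]pol_mkvecK P1; apply: eq_mkvec; exact: QT.
have [p -> dp] := iterP N.+3.
apply: vec_eq0; first exact: coord1_mkvec.
rewrite pol_mkvec (_ : take_poly _ p = 0) ?dvdp0 //; apply/polyP => k.
by rewrite coef_take_poly coef0; case: ifP => // lt_k; exact: dvdXnP dp k lt_k.
Qed.

End Prederivation.

End Coordinates.

(** * Reduction to a congruence on phi *)

Section Characterization.
Variables (K : numFieldType) (N : nat) (alpha : nat -> K) (theta : K).
Hypothesis n_gt4 : (4 < N.+4)%N.
Local Notation L := (F1 n_gt4 alpha theta).
Local Notation phi := (phi N alpha).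

Lemma coef_pre_eqn a b (p : {poly K}) k : (pre_eqn a b p)`_k =
  a * (k.+1%:R * p`_k)
  + (b - a) * (\sum_(i < k.+1) i.+1%:R * p`_i * p`_(k - i)%N) - b * p`_k.
Proof.
have -> : pre_eqn a b p = a%:P * ('X * p^`() + p)
    + (b - a)%:P * (('X * p^`() + p) * p) - b%:P * p by rewrite /pre_eqn; ring.
have psiE i : ('X * p^`() + p)`_i = i.+1%:R * p`_i.
  rewrite coefD coefXM; case: i => [|i] /=; first by rewrite add0r mul1r.
  by rewrite coef_deriv -[_ *+ _]mulr_natl -[i.+2%:R]natr1 mulrDl mul1r.
rewrite coefB coefD !mul_polyC !coefZ psiE coefM; congr (_ + _ * _ - _).
by apply: eq_bigr => i _; rewrite psiE.
Qed.

Lemma two_neq0 : 2 != 0 :> K. Proof. by rewrite pnatr_eq0. Qed.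

Lemma pre_eqn_catalan m c : (0 < m)%N ->
  (forall k, (k < N)%N -> phi`_k = catalan_coef m c k) ->
  'X^N %| pre_eqn 1 m.+1%:R phi.
Proof.
move=> m0 phiE; apply/dvdXnP => k lt_k; rewrite coef_pre_eqn phiE //.
rewrite (eq_bigr (fun i : 'I_k.+1 => i.+1%:R * catalan_coef m c i
   * catalan_coef m c (k - i)%N)) => [|i _].
  rewrite -[RHS](catalan_coef_rec c k m0) -!natr1; ring.
have lt_i := ltn_ord i.
by rewrite !phiE //; lia.
Qed.

Lemma catalan_of_pre_eqn a b : (a != 0) || (b != 0) -> 'X^N %| pre_eqn a b phi ->
  exists m c, (0 < m)%N /\ forall k, (k < N)%N -> phi`_k = catalan_coef m c k.
Proof.
move=> nz_ab /dvdXnP eqn.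
case: (boolP [exists k : 'I_N, phi`_k != 0]) => [/existsP[k0 nzk0] | ]; last first.
  rewrite negb_exists => /forallP phi0; exists 1%N, 0; split=> // k lt_k.
  have := phi0 (Ordinal lt_k); rewrite negbK => /eqP /= ->.
  rewrite /catalan_coef; case: ifP => // /andP[_ k_gt0].
  by rewrite expr0n divn1 eqn0Ngt k_gt0 mulr0.
have ex_m : exists k, phi`_k != 0 by exists k0.
case: (ex_minnP ex_m) => m nz_m min_m.
have lt_m k : (k < m)%N -> phi`_k = 0.
  by move=> lt_km; apply: contraTeq lt_km => /min_m; rewrite -leqNgt.
have lt_mN : (m < N)%N by apply: leq_ltn_trans (ltn_ord k0); exact: min_m.
have m_gt0 : (0 < m)%N.
  by rewrite lt0n; apply: contraNneq nz_m => ->; rewrite phi_coef0.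
(* At the lowest degree m of phi the quadratic part vanishes, so the equation becomes ((m + 1) a -
   b) phi_m = 0. *)
have sum0 : \sum_(i < m.+1) i.+1%:R * phi`_i * phi`_(m - i)%N = 0.
  rewrite big1 // => i _; have := ltn_ord i; rewrite ltnS leq_eqVlt.
  case/predU1P => [->|/lt_m ->]; last by rewrite mulr0 mul0r.
  by rewrite subnn phi_coef0 mulr0.
have bE : b = m.+1%:R * a.
  have := eqn m lt_mN; rewrite coef_pre_eqn sum0 mulr0 addr0 mulrA -mulrBl.
  by move/eqP; rewrite mulf_eq0 (negPf nz_m) orbF subr_eq0 mulrC => /eqP.
have nz_a : a != 0.
  by apply: contraTneq nz_ab => a0; rewrite bE a0 mulr0 eqxx.
exists m, phi`_m; split=> //; apply: catalan_coef_unique => // k lt_k.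
have := eqn k lt_k; rewrite coef_pre_eqn bE => E.
apply: (mulfI nz_a); rewrite mulr0 -[RHS]E -[k.+1%:R]natr1 -[m.+1%:R]natr1.
by ring.
Qed.

Lemma not_strongly_nilpotent_even :
  'X^(N.+1) %| phi - sigma phi -> ~ strongly_nilpotent L.
Proof.
move=> dphi SN.
have eqn1 : 'X^(N.+1) %| pre_eqn 0 0 phi + (2^-1)%:P * (phi - sigma phi).
  by rewrite /pre_eqn subrr polyC0 !mul0r addr0 mul0r subr0 add0r dvdp_mull.
have eqn2 : 'X^(N.+1) %| 'X * ((2^-1)%:P * (phi - sigma phi)).
  by rewrite !dvdp_mull.
have nil := SN _ (@pre_map_prederivation _ _ _ theta n_gt4 _ _ _ eqn1 eqn2).
(* X is fixed, since (X - sigma X) / 2 = X. *)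
apply: (@eigen_not_nilpotent _ _ _ _ n_gt4 _ (mkvec N 0 'X) _ (oner_neq0 K) _ _ nil).
  apply/eqP => /(congr1 (fun w : 'rV_N.+4 => (pol w)`_1)).
  rewrite pol_mkvec coef_take_poly coefX linear0 coef0 /=.
  by apply/eqP; rewrite oner_neq0.
rewrite scale1r /= /pre_map mul0r pol_mkvec take_poly_id ?size_polyX //.
congr (mkvec _ _ _); rewrite /twisted_der sigmaX subrr polyC0.
transitivity ((2^-1)%:P * 2 * 'X : {poly K}); first by ring.
by rewrite -(polyC_natr K 2) -polyCM mulVf ?two_neq0 // mul1r.
Qed.

Lemma not_strongly_nilpotent_pre_eqn b : ~~ ('X^(N.+1) %| phi - sigma phi) ->
  'X^N %| pre_eqn 1 b phi -> ~ strongly_nilpotent L.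
Proof.
set D := phi - sigma phi => ndD eqnN SN.
have ex_k : exists k, D`_k != 0.
  have D0 : D != 0 by apply: contraNneq ndD => ->; rewrite dvdp0.
  by exists (size D).-1; rewrite -lead_coefE lead_coef_eq0.
case: (ex_minnP ex_k) => k nz_k min_k.
have /dvdpP[s Ds] : 'X^k %| D.
  apply/dvdXnP => j lt_jk; apply: contraTeq lt_jk => /min_k.
  by rewrite -leqNgt.
have le_kN : (k <= N)%N.
  by rewrite leqNgt; apply: contraNN ndD => lt; rewrite Ds dvdp_mull // dvdp_exp2l.
have /dvdpP[r Er] := eqnN.
have s0 : s`_0 != 0 by move: nz_k; rewrite Ds coefMXn ltnn subnn.
(* v D only has to cancel the coefficient of X^N in pre_eqn. *)
pose v : {poly K} := (- (r`_0 / s`_0))%:P * 'X^(N - k).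
have vD : v * D = (- (r`_0 / s`_0))%:P * s * 'X^N.
  by rewrite /v Ds mulrACA -exprD subnK.
have eqn1 : 'X^(N.+1) %| pre_eqn 1 b phi + v * D.
  rewrite vD Er -mulrDl exprS dvdp_mul // -['X]expr1; apply/dvdXnP => -[|] // _.
  by rewrite coefD mul_polyC coefZ mulNr divfK // subrr.
have eqn2 : 'X^(N.+1) %| 'X * (v * D).
  by rewrite exprS dvdp_mul // vD dvdp_mulIr.
have nil := SN _ (@pre_map_prederivation _ _ _ theta n_gt4 _ _ _ eqn1 eqn2).
(* The vector d is fixed, its eigenvalue being a = 1. *)
apply: (@eigen_not_nilpotent _ _ _ _ n_gt4 _ (mkvec N 1 0) _ (oner_neq0 K) _ _ nil).
  apply/eqP => /(congr1 (@coord1 K N)).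
  by rewrite coord1_mkvec linear0; apply/eqP; rewrite oner_neq0.
rewrite scale1r /= /pre_map coord1_mkvec mulr1 pol_mkvec take_poly0r.
by congr (mkvec _ _ _); rewrite /twisted_der /sigma deriv0 comp_poly0 subrr; ring.
Qed.

Lemma not_strongly_nilpotentP : ~ strongly_nilpotent L <->
  'X^(N.+1) %| phi - sigma phi \/
  exists m c, (0 < m)%N /\ forall k, (k < N)%N -> phi`_k = catalan_coef m c k.
Proof.
case: (boolP ('X^(N.+1) %| phi - sigma phi)) => [dphi | ndphi].
  by split=> _; [left | exact: not_strongly_nilpotent_even].
split=> [nSN | [// | [m [c [m0 phiE]]]]]; last first.
  exact: not_strongly_nilpotent_pre_eqn ndphi (pre_eqn_catalan m0 phiE).
right; have [P [preP nP]] : exists P : {linear L -> L}, prederivation P /\ ~ nilpotent_map P.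
  apply: NNPP => nex; apply: nSN => P preP; apply: NNPP => nP.
  by apply: nex; exists P.
have [//|[a [b [nz_ab eqn]]]] := pre_eqn_of_prederivation two_neq0 ndphi preP.
exact: catalan_of_pre_eqn nz_ab eqn.
Qed.

End Characterization.

(** * Translation to the parameters *)

Section ParameterConditions.
Variables (K : numFieldType) (N : nat) (alpha : nat -> K).
Local Notation phi := (phi N alpha).

(** At k the difference has coefficient 2 alpha_(k+3) if k is odd and 0 if k is even; the odd k up
    to N give the even indices from 4 to n - 1. *)
Lemma even_phiP : odd N -> 'X^(N.+1) %| phi - sigma phi <->
  (forall i, (2 <= i <= (N.+4 - 1) %/ 2)%N -> alpha (2 * i)%N = 0).
Proof.
move=> N_odd; split=> [/dvdXnP d i le_i | a0].
  have lt_k : (2 * i - 3 < N.+1)%N by lia.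
  have odd_k : odd (2 * i - 3) by lia.
  have := d _ lt_k; rewrite coefB coef_sigma -signr_odd odd_k expr1 mulN1r opprK.
  rewrite coef_phi; last lia.
  rewrite ifN; last lia.
  rewrite (_ : (2 * i - 3 + 3 = 2 * i)%N); last lia.
  rewrite -mulr2n -mulr_natl => /eqP.
  by rewrite mulf_eq0 pnatr_eq0 => /eqP.
apply/dvdXnP => k lt_k; rewrite coefB coef_sigma -signr_odd coef_phi; last lia.
case: ifP => [_|k0]; first by rewrite mulr0 subrr.
case: (boolP (odd k)) => [odd_k|_]; last by rewrite mul1r subrr.
rewrite (_ : (k + 3 = 2 * ((k + 3) %/ 2))%N); last lia.
by rewrite a0 ?mulr0 ?subrr //; lia.
Qed.

Lemma phi_catalanP m c :
  (forall k, (k < N)%N -> phi`_k = catalan_coef m c k) <->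
  (forall k, (0 < k < N)%N -> alpha (k + 3)%N = catalan_coef m c k).
Proof.
split=> [E k /andP[k0 lt_k] | E k lt_k].
  by rewrite -E // coef_phi; [rewrite gtn_eqF | lia].
rewrite coef_phi; last lia.
by case: (posnP k) => [->|k0]; rewrite ?catalan_coef0 // E ?k0.
Qed.

Lemma catalan_coefP m : (0 < m < N)%N ->
  (forall k, (0 < k < N)%N -> alpha (k + 3)%N = catalan_coef m (alpha (m + 3)%N) k)
  <->
  (forall t, (1 <= t <= (N.+4 - 5) %/ m)%N -> alpha (m * t + 3)%N =
     (-1) ^+ t.+1 * catalan m.+1 t * alpha (m + 3)%N ^+ t)
  /\ (forall j, (4 <= j <= N.+4 - 2)%N ->
       ~ (exists t, (0 < t)%N /\ j = (m * t + 3)%N) -> alpha j = 0).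
Proof.
move=> /andP[m0 lt_mN]; split=> [E | [E1 E2] k /andP[k0 lt_k]].
  split=> [t /andP[t0 le_t] | j /andP[le4j le_j] nj].
    have le_mt : (m * t <= N.+4 - 5)%N by rewrite mulnC -leq_divRL.
    by rewrite E ?catalan_coef_mul //; nia.
  rewrite (_ : j = (j - 3 + 3)%N); last lia.
  rewrite E; last lia.
  apply: catalan_coef_ndvd; apply/negP => /dvdnP[q Eq]; apply: nj.
  by exists q; nia.
case: (boolP (m %| k)%N) => [/dvdnP[t Ek] | ndk].
  have t0 : (0 < t)%N by nia.
  rewrite Ek mulnC catalan_coef_mul // E1 // t0 leq_divRL //; nia.
rewrite catalan_coef_ndvd // E2 //; first lia.
case=> t [_ /addIn Ek]; case/negP: ndk; rewrite Ek; exact: dvdn_mulr.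
Qed.

End ParameterConditions.

Theorem theorem4p3 (R : realType) (n : nat) (n_ge5 : (5 <= n)%N) (n_odd : odd n)
    (alpha : nat -> R[i]) (theta : R[i]) :
  ~ strongly_nilpotent (F1 n_ge5 alpha theta) <->
  [\/ alpha 4%N != 0 /\
      (forall k : nat, (5 <= k <= n - 2)%N ->
         alpha k = (-1) ^+ k * catalan 2 (k - 3) * alpha 4%N ^+ (k - 3)),
      exists s : nat,
        [/\ (3 <= s <= (n - 3) %/ 2)%N,
            (forall t : nat, (1 <= t <= (n - 5) %/ (2 * s - 3))%N ->
               alpha ((2 * s - 3) * t + 3)%N =
                 (-1) ^+ t.+1 * catalan (2 * s - 2) t * alpha (2 * s)%N ^+ t)
          & (forall j : nat, (4 <= j <= n - 2)%N ->
               ~ (exists t : nat,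
                    (0 < t)%N /\ j = ((2 * s - 3) * t + 3)%N) ->
               alpha j = 0)],
      (forall i : nat, (2 <= i <= (n - 1) %/ 2)%N -> alpha (2 * i)%N = 0)
    | exists s : nat,
        [/\ (2 <= s <= (n - 3) %/ 2)%N,
            (forall t : nat, (1 <= t <= (n - 5) %/ (2 * s - 2))%N ->
               alpha ((2 * s - 2) * t + 3)%N =
                 (-1) ^+ t.+1 * catalan (2 * s - 1) t
                   * alpha (2 * s + 1)%N ^+ t)
          & (forall j : nat, (4 <= j <= n - 2)%N ->
               ~ (exists t : nat,
                    (0 < t)%N /\ j = ((2 * s - 2) * t + 3)%N) ->
               alpha j = 0)]].
Proof.
case: n n_ge5 n_odd => [|[|[|[|N]]]] // n_ge5; rewrite /= !negbK => N_odd.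
rewrite (@not_strongly_nilpotentP _ _ alpha theta n_ge5) (even_phiP alpha N_odd).
have N0 : (0 < N)%N by case: (N) N_odd.
have sgnE k : (3 <= k)%N -> (-1) ^+ k = (-1) ^+ (k - 3).+1 :> R[i].
  move=> le3k; rewrite -signr_odd -[in RHS]signr_odd.
  by congr ((-1) ^+ _); lia.
set goal := [\/ _, _, _ | _]; split=> [[iii | [m [c [m0 /phi_catalanP E]]]] | ].
- by constructor 3.
(* All alpha_j with 4 <= j <= n - 2 vanish: case iv with s = 2, except for n = 5,
   where this is i or iii. *)
- have degenerate : (forall k, (0 < k < N)%N -> alpha (k + 3)%N = 0) -> goal.
    move=> a0; case: (ltnP N 2) => [lt_N2 | lt1N].
      have N1 : N = 1%N by lia.
      have [a4 | a4] := eqVneq (alpha 4%N) 0.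
        by constructor 3 => i le_i; rewrite (_ : i = 2%N) //; lia.
      by constructor 1; split=> // k; lia.
    have a0' j : (4 <= j <= N.+4 - 2)%N -> alpha j = 0.
      by move=> le_j; rewrite (_ : j = (j - 3 + 3)%N) ?a0 //; lia.
    constructor 4; exists 2%N; split; [lia| |by move=> j /a0'].
    move=> t /andP[t0 le_t]; rewrite !a0'; [|lia|].
      by rewrite expr0n eqn0Ngt t0 mulr0.
    move: le_t; rewrite leq_divRL //; lia.
  case: (ltnP m N) => [lt_mN | le_Nm]; last first.
    apply: degenerate => k lt_k; rewrite E // catalan_coef_lt //; lia.
  have Ec : c = alpha (m + 3)%N by rewrite E ?m0 // catalan_coef_first.
  rewrite Ec in E.
  have [E1 E2] := (catalan_coefP alpha (introT andP (conj m0 lt_mN))).1 E.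
  (* The first degree m is 1 in case i, 2s - 3 in case ii and 2s - 2 in case iv. *)
  case: (boolP (odd m)) => [odd_m | even_m].
    have [m1 | m_neq1] := eqVneq m 1%N.
      have [a4 | a4] := eqVneq (alpha 4%N) 0.
        apply: degenerate => k /[dup] lt_k /andP[k0 _].
        by rewrite E // m1 a4 /catalan_coef k0 divn1 expr0n eqn0Ngt k0 mulr0 if_same.
      constructor 1; split=> // k le_k; rewrite m1 in E1.
      rewrite (_ : alpha k = alpha (1 * (k - 3) + 3)%N); last by congr alpha; lia.
      rewrite E1; last by rewrite divn1; lia.
      by rewrite (sgnE k); last lia.
    constructor 2; exists ((m + 3) %/ 2)%N.
    have -> : (2 * ((m + 3) %/ 2) - 3 = m)%N by lia.
    have -> : (2 * ((m + 3) %/ 2) - 2 = m.+1)%N by lia.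
    have -> : (2 * ((m + 3) %/ 2) = m + 3)%N by lia.
    by split=> //; lia.
  constructor 4; exists ((m + 2) %/ 2)%N.
  have -> : (2 * ((m + 2) %/ 2) - 2 = m)%N by lia.
  have -> : (2 * ((m + 2) %/ 2) - 1 = m.+1)%N by lia.
  have -> : (2 * ((m + 2) %/ 2) + 1 = m + 3)%N by lia.
  by split=> //; lia.
case=> [[_ E] | [s [le_s E1 E2]] | iii | [s [le_s E1 E2]]]; [right|right|by left|right].
- exists 1%N, (alpha 4%N); split=> //; apply/phi_catalanP => k /andP[k0 lt_k].
  (* Case i constrains the parameters only from alpha_5 on; k = 1 is alpha_4, the free coefficient
     c. *)
  case: (ltnP k 2) => [lt_k2 | lt1k].
    have -> : k = 1%N by lia.
    by rewrite catalan_coef_first.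
  rewrite /catalan_coef dvd1n k0 divn1.
  rewrite E; last lia.
  by rewrite (sgnE (k + 3)%N) ?leq_addl // !addnK.
- exists (2 * s - 3)%N, (alpha (2 * s)%N); split; first lia.
  apply/phi_catalanP; rewrite [X in alpha X](_ : _ = 2 * s - 3 + 3)%N; last lia.
  apply/catalan_coefP; first lia.
  have -> : ((2 * s - 3).+1 = 2 * s - 2)%N by lia.
  by have -> : (2 * s - 3 + 3 = 2 * s)%N by lia.
exists (2 * s - 2)%N, (alpha (2 * s + 1)%N); split; first lia.
apply/phi_catalanP; rewrite [X in alpha X](_ : _ = 2 * s - 2 + 3)%N; last lia.
apply/catalan_coefP; first lia.
have -> : ((2 * s - 2).+1 = 2 * s - 1)%N by lia.
by have -> : (2 * s - 2 + 3 = 2 * s + 1)%N by lia.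
Qed.
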